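(* For every positive integer $n$, $$\frac{\lfloor n/2\rfloor!}{2^{\lfloor n/2\rfloor}}\;\leq\; M(n,2)\;\leq\; 2^{\lceil n/2\rceil}\,\lceil n/2\rceil!,$$ where $M(n,2)$ is the largest cardinality of a family of Hamilton paths in the complete graph $K_n$ such that for any two distinct members of the family there is a path on 3 vertices (2 edges) both of whose edges are contained in one of the two Hamilton paths and neither of whose edges belongs to the other.
   Context: $K_n$ is the complete graph with vertex set $[n]=\{1,\dots,n\}$. Hamilton paths are undirected: a Hamilton path in $K_n$ is a subgraph that is a path visiting all $n$ vertices, identified with its edge set (so a vertex ordering and its reversal give the same Hamilton path). *)

(* Defs.v *)
From mathcomp Require Import all_boot.

Set Implicit Arguments.
Unset Strict Implicit.
Unset Printing Implicit Defensive.

Section HamiltonPaths.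

Variable n : nat.

(* A graph on the vertex set 'I_n is represented by its edge set, an edge
   being a two-element set of vertices. *)
Implicit Types (H K : {set {set 'I_n}}) (F : {set {set {set 'I_n}}}).

Definition path_edges (s : seq 'I_n) : {set {set 'I_n}} :=
  [set [set e.1; e.2] | e in zip s (behead s)].

Definition hamilton_paths : {set {set {set 'I_n}}} :=
  [set H | [exists s : n.-tuple 'I_n, uniq s && (H == path_edges s)]].

Definition path3_outside H K : bool :=
  [exists s : 3.-tuple 'I_n, uniq s && (path_edges s \subset H :\: K)].

Definition two_different_family F : bool :=
  (F \subset hamilton_paths) &&
  [forall H in F, forall K in F,
     (H != K) ==> (path3_outside H K || path3_outside K H)].

End HamiltonPaths.

(* Written M(n,2); the 2 counts the edges of the distinguishing path. *)
Definition M2 (n : nat) : nat :=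
  \max_(F : {set {set {set 'I_n}}} | two_different_family F) #|F|.

(* Main.v *)
(** Upper bound.  The edges in odd positions of a Hamilton path, together with
    the last vertex when [n] is odd, split the vertices into [uphalf n] blocks of
    size at most 2.  Two consecutive edges of the path always include one of
    these blocks, so two different members of the family have different splittings,
    of which there are at most [2 ^ uphalf n * (uphalf n)`!].

    Lower bound.  Put [m = n./2] and keep the even vertices at their places; a
    permutation of the [m] odd vertices among the remaining places gives a
    Hamilton path.  If an odd vertex is shifted by at least two steps between two
    such paths, its neighbourhoods in the two paths are disjoint.  At most [2 ^ m]
    permutations stay within one step of a given one, so a maximal family of
    permutations that are pairwise not within one step has at least
    [m`! / 2 ^ m] members. *)

Require Import Defs.
From mathcomp Require Import all_boot all_order all_algebra all_fingroup.
From mathcomp Require Import zify.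

Set Implicit Arguments.
Unset Strict Implicit.
Unset Printing Implicit Defensive.

Import Order.TTheory GRing.Theory Num.Theory.
Local Open Scope ring_scope.

Lemma leq_card_bigcup (I T : finType) (A : {set I}) (F : I -> {set T}) :
  (#|\bigcup_(i in A) F i| <= \sum_(i in A) #|F i|)%N.
Proof.
elim/big_rec2: _ => [|i k D _ leD]; first by rewrite cards0.
by apply: leq_trans (leq_card_setU _ _) _; rewrite leq_add2l.
Qed.

(** * Partitions into blocks of size at most 2, and their number *)

Section Pairings.

Local Open Scope nat_scope.

Variable T : finType.
Implicit Types (s : seq T) (A : {set T}) (P : {set {set T}}).

Definition pairings A m : {set {set {set T}}} :=
  [set P | [&& partition P A, [forall B in P, #|B| <= 2] & #|P| == m]].

(** Splitting off the block of [x] is the recursion behind the count. A singleton block is covered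
    by [y = x]. *)
Lemma pairingsD1 A m P x (xA : x \in A) :
  P \in pairings A m.+1 -> exists2 y, y \in A &
    [set x; y] \in P /\ P :\ [set x; y] \in pairings (A :\: [set x; y]) m.
Proof.
rewrite inE => /and3P[partP /forall_inP leP2 /eqP cardP].
have [/eqP covP tiP _] := and3P partP.
have xP : x \in cover P by rewrite covP.
have BP := pblock_mem xP; set B := pblock P x in BP.
have xB : x \in B by rewrite mem_pblock.
have [y yB defB] : exists2 y, y \in B & B = [set x; y].
  have := leP2 _ BP; rewrite (cardsD1 x) xB add1n ltnS.
  rewrite leq_eqVlt ltnS leqn0 => /orP[/cards1P[y By]|].
    have : y \in B :\ x by rewrite By set11.
    by case/setD1P=> _ yB; exists y; rewrite // -(setD1K xB) By.
  by rewrite cards_eq0 => /eqP B0; exists x; rewrite // -(setD1K xB) B0 setU0 setUid.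
exists y; first by rewrite -covP; apply/bigcupP; exists B.
rewrite -defB; split=> //; rewrite inE; apply/and3P; split.
- exact: partitionD1.
- by apply/forall_inP=> C /setD1P[_ /leP2].
- by move/eqP: cardP; rewrite (cardsD1 B) BP add1n eqSS.
Qed.

(** Induction on [m]: fix [x] in [A], choose the partner [y] of [x], then partition the rest. Each
    step contributes a factor of at most [2 * m.+1]. *)
Lemma card_pairings A m : #|pairings A m| <= 2 ^ m * m`!.
Proof.
elim: m A => [|m IHm] A.
  apply: leq_trans (_ : #|[set (set0 : {set {set T}})]| <= _); last by rewrite cards1.
  apply: subset_leq_card.
  by apply/subsetP=> P; rewrite !inE => /and3P[_ _]; rewrite cards_eq0.
have [A0|[x xA]] := set_0Vmem A.
  rewrite (_ : pairings A _ = set0) ?cards0 //; apply/setP=> P; rewrite !inE A0.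
  by apply/negP=> /and3P[/[!partition_set0]/eqP-> _]; rewrite cards0.
(* A set with more than [m.+1.*2] elements cannot be covered by [m.+1] blocks of size at most 2, so
   only boundedly many partners [y] need to be considered. *)
have [leA|ltA] := leqP #|A| m.+1.*2; last first.
  rewrite (_ : pairings A _ = set0) ?cards0 //; apply/setP=> P; rewrite !inE.
  apply/negP=> /and3P[/card_partition cardA /forall_inP leP2 /eqP cardP].
  have : #|A| <= \sum_(B in P) 2 by rewrite cardA leq_sum.
  by rewrite sum_nat_const cardP; lia.
pose f y P := [set x; y] |: P.
pose C y := f y @: pairings (A :\: [set x; y]) m.
have sub : pairings A m.+1 \subset \bigcup_(y in A) C y.
  apply/subsetP=> P /(pairingsD1 xA)[y yA [xyP P'in]].
  by apply/bigcupP; exists y => //; rewrite -(setD1K xyP); apply: imset_f.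
apply: leq_trans (subset_leq_card sub) _.
apply: leq_trans (leq_card_bigcup _ _) _.
apply: leq_trans (_ : \sum_(y in A) 2 ^ m * m`! <= _).
  by apply: leq_sum => y _; apply: leq_trans (leq_imset_card _ _) (IHm _).
rewrite sum_nat_const factS expnS -mul2n mulnACA in leA *.
by rewrite leq_mul2r leA orbT.
Qed.

Fixpoint pairing s : {set {set T}} :=
  match s with
  | x :: y :: s' => [set x; y] |: pairing s'
  | [:: x] => [set [set x]]
  | [::] => set0
  end.

Lemma seq_step2_ind (Q : seq T -> Prop) :
  Q [::] -> (forall x, Q [:: x]) -> (forall x y s, Q s -> Q [:: x, y & s]) ->
  forall s, Q s.
Proof.
move=> Q0 Q1 Q2 s; elim: (size s) {-2}s (leqnn (size s)) => [|k IHk] [|x [|y t]] //=.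
by move=> le_t; apply/Q2/IHk; lia.
Qed.

Lemma pairing_pairings s :
  uniq s -> pairing s \in pairings [set:: s] (uphalf (size s)).
Proof.
elim/seq_step2_ind: s => [_|x _|x y s IHs /=].
- rewrite inE set_nil partition_set0 eqxx cards0 /= andbT.
  by apply/forall_inP=> B; rewrite inE.
- rewrite inE cards1 /= andbT set_cons set_nil setU0; apply/andP; split.
    apply/and3P; split; first by rewrite /cover big_set1.
      by apply/trivIsetP=> B C /set1P-> /set1P->; rewrite eqxx.
    by rewrite inE eq_sym -cards_eq0 cards1.
  by apply/forall_inP=> B /set1P->; rewrite cards1.
rewrite inE negb_or => /and3P[/andP[xy xs] ys us].
move: (IHs us); rewrite !inE => /and3P[/and3P[/eqP cov ti n0]].
move=> /forall_inP le2 /eqP cardP.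
have dis B : B \in pairing s -> [disjoint [set x; y] & B].
  move=> Bs; apply/pred0P=> z /=; apply/negP=> /andP[zxy zB].
  have : z \in [set:: s] by rewrite -cov; apply/bigcupP; exists B.
  by rewrite inE; case/set2P: zxy => ->; apply/negP.
have nin : [set x; y] \notin pairing s.
  by apply/negP=> /dis/pred0P/(_ x)/=; rewrite set21.
apply/and3P; split; last by rewrite cardsU1 nin cardP.
  apply/and3P; split.
  - rewrite /cover bigcup_setU big_set1 -/(cover _) cov.
    by apply/eqP/setP=> z; rewrite !inE orbA.
  - apply/trivIsetP=> B C /setU1P[->|Bs] /setU1P[->|Cs]; rewrite ?eqxx //.
    + by move=> _; apply: dis.
    + by move=> _; rewrite disjoint_sym; apply: dis.
    + exact: (trivIsetP ti).
  - rewrite in_setU1 negb_or n0 andbT eq_sym -cards_eq0 cards2; lia.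
by apply/forall_inP=> B /setU1P[->|/le2//]; rewrite cards2; lia.
Qed.

End Pairings.

(** * A family member is determined by its pairing *)

Section UpperBound.

Local Open Scope nat_scope.

Variable n : nat.
Implicit Types (s t : seq 'I_n).

Lemma path_edges_cons2 x y s :
  path_edges [:: x, y & s] = [set x; y] |: path_edges (y :: s).
Proof.
apply/setP=> e; rewrite in_setU1; apply/imsetP/orP => [[p]|[/eqP->|/imsetP[p ps ->]]].
- rewrite /= in_cons => /predU1P[-> ->|ps ->]; first by left.
  by right; apply/imsetP; exists p.
- by exists (x, y); rewrite //= mem_head.
- by exists p; rewrite //= in_cons ps orbT.
Qed.

Lemma path_edges_small s : size s <= 1 -> path_edges s = set0.
Proof.
case: s => [|x []] //= _; apply/setP=> e; rewrite in_set0; apply/imsetP.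
  by case.
by case.
Qed.

(** Edges in odd positions are blocks of [pairing s], and edges in even positions are blocks of
    [pairing (behead s)]; dropping the first vertex swaps the two roles. Only inclusion holds,
    because of a possible final singleton. *)
Lemma path_edges_pairing s :
  path_edges s \subset pairing s :|: pairing (behead s).
Proof.
elim: s => [|x [|y s] IHs]; try by rewrite path_edges_small ?sub0set.
rewrite path_edges_cons2; apply/subsetP=> e /setU1P[->|/(subsetP IHs)].
  by rewrite !inE eqxx.
by rewrite /= !inE => /orP[->|->]; rewrite ?orbT.
Qed.

(** The condition [#|e| = 2] excludes the final singleton block, which is not an edge. *)
Lemma pairing_path_edges s (e : {set 'I_n}) :
    #|e| = 2 -> e \in pairing s ->
  e \in path_edges s.
Proof.
move=> e2; elim/seq_step2_ind: s => [|x|x y s IHs]; first by rewrite inE.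
  by move=> /set1P ex; move: e2; rewrite ex cards1.
rewrite path_edges_cons2 !in_setU1 => /orP[->//|/IHs es].
case: s es {IHs} => [|z s] es; first by rewrite path_edges_small // inE in es.
by rewrite path_edges_cons2 in_setU1 es !orbT.
Qed.

(** Otherwise both edges would be blocks of [pairing (behead s)]; these are pairwise disjoint,
    whereas the two edges are different and share [y]. *)
Lemma path3_meets_pairing s x y z :
    uniq s -> uniq [:: x; y; z] ->
    [set x; y] \in path_edges s -> [set y; z] \in path_edges s ->
  [set x; y] \in pairing s \/ [set y; z] \in pairing s.
Proof.
move=> us uxyz /(subsetP (path_edges_pairing s)) /setUP[|xy]; first by left.
move=> /(subsetP (path_edges_pairing s)) /setUP[|yz]; first by right.
have ub : uniq (behead s) by case: s us {xy yz} => //= a s /andP[].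
have := pairing_pairings ub; rewrite inE => /and3P[/and3P[_ ti _] _ _].
have [eq_e|/(trivIsetP ti _ _ xy yz)] := eqVneq [set x; y] [set y; z].
  have : x \in [set y; z] by rewrite -eq_e set21.
  by move: uxyz; rewrite /= !inE => /andP[/negPf->].
by move=> /pred0P/(_ y)/=; rewrite set21 set22.
Qed.

(** One of the two edges of a 3-vertex path in [s] is a block of the common pairing, hence also an
    edge of [t]. *)
Lemma pairing_no_path3 s t : uniq s -> pairing s = pairing t ->
  ~~ path3_outside (path_edges s) (path_edges t).
Proof.
move=> us eq_st; apply/negP=> /existsP[[[|x [|y [|z []]]] //= ?]] /andP[uxyz].
have e3 : path_edges [:: x; y; z] = [set [set x; y]; [set y; z]].
  by rewrite !path_edges_cons2 path_edges_small // setU0.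
rewrite e3 subUset !sub1set => /andP[/setDP[xys xyt] /setDP[yzs yzt]].
have [xy yz] : x != y /\ y != z.
  by move: uxyz; rewrite /= !inE negb_or => /and3P[/andP[]].
case: (path3_meets_pairing us uxyz xys yzs); rewrite eq_st => /pairing_path_edges.
  by rewrite cards2 xy => /(_ erefl); apply/negP.
by rewrite cards2 yz => /(_ erefl); apply/negP.
Qed.

Lemma M2_upper : M2 n <= 2 ^ uphalf n * (uphalf n)`!.
Proof.
apply/bigmax_leqP=> F /andP[/subsetP hamF /forall_inP diffF].
(* An arbitrary vertex ordering of each path is fixed, since for odd [n] the pairing may change
   under reversal. The default [[::]] does not occur for [H] in [F]. *)
pose tour (H : {set {set 'I_n}}) : seq 'I_n :=
  if [pick s : n.-tuple 'I_n | uniq s && (H == path_edges s)] is Some s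
  then s else [::].
have tourP H : H \in F ->
    [/\ uniq (tour H), size (tour H) = n & path_edges (tour H) = H].
  move=> /hamF; rewrite inE /tour => /existsP exs.
  case: pickP => [s /andP[us /eqP->]|no]; first by rewrite size_tuple.
  by case: exs => s; rewrite no.
apply: leq_trans (card_pairings [set: 'I_n] (uphalf n)).
rewrite -(card_in_imset (f := fun H => pairing (tour H)) (D := F)); last first.
  move=> H K HF KF eqHK; apply/eqP/negPn/negP=> neqHK.
  have [uH _ eH] := tourP _ HF; have [uK _ eK] := tourP _ KF.
  move: (forall_inP (diffF H HF) K KF); rewrite neqHK /= => /orP[].
    by rewrite -eH -eK; apply/negP/pairing_no_path3.
  by rewrite -eH -eK; apply/negP/pairing_no_path3.
apply/subset_leq_card/subsetP=> _ /imsetP[H HF ->].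
have [uH sizeH _] := tourP _ HF.
suff <- : [set:: tour H] = [set: 'I_n].
  by have := pairing_pairings uH; rewrite sizeH.
apply/eqP; rewrite eqEcard subsetT cardsT card_ord /=.
by rewrite cardsE (card_uniqP uH) sizeH.
Qed.

End UpperBound.

(** * Permutations that are pairwise far apart *)

Section LowerBound.

Local Open Scope nat_scope.

(** Take an inclusion-maximal clique: a point outside it that is related in both directions to every
    member could be added. Both directions appear because cliques are tested on ordered pairs. *)
Lemma maximal_clique (T : finType) (r : rel T) :
  exists2 G : {set T}, {in G &, forall x y, x != y -> r x y} &
    forall x, exists2 y, y \in G & x = y \/ ~~ (r x y && r y x).
Proof.
pose clique (G : {set T}) :=
  [forall x in G, forall y in G, (x != y) ==> r x y].
have clique0 : clique set0 by apply/forall_inP=> x; rewrite inE.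
have [G /maxsetP[cG maxG] _] := maxset_exists clique0.
have GP : {in G &, forall x y, x != y -> r x y}.
  by move=> x y xG yG; apply/implyP/(forall_inP (forall_inP cG x xG)).
exists G => // x; have [xG|xG] := boolP (x \in G); first by exists x; auto.
have [/exists_inP[y yG rxy]|none] := boolP [exists y in G, ~~ (r x y && r y x)].
  by exists y; auto.
case/negP: xG; rewrite -(maxG (x |: G)) ?setU11 ?subsetUr //.
have rG y : y \in G -> r x y && r y x.
  by move=> yG; apply/negPn/negP=> nr; case/exists_inP: none; exists y.
apply/forall_inP=> y yG; apply/forall_inP=> z zG; apply/implyP.
move: yG zG => /setU1P[->|yG] /setU1P[->|zG]; rewrite ?eqxx //.
- by have /andP[] := rG z zG.
- by have /andP[] := rG y yG.
- exact: GP.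
Qed.

(** The maximum distance between [p] and [q] is at least 2. *)
Definition far m (p q : 'S_m) :=
  [exists b, ((p b).+1 < q b) || ((q b).+1 < p b)].

Lemma far_sym m : symmetric (@far m).
Proof. by move=> p q; apply: eq_existsb => b; rewrite orbC. Qed.

(** A permutation [p] near [q] is recovered from the set [up p] of points it sends one step above
    [q]. Going through the points [b] by increasing [q b], a point outside [up p] goes to [(q b).-1]
    exactly when [q b] is positive and no earlier point has taken that place. *)
Lemma card_near m (q : 'S_m) : #|[set p | ~~ far p q]| <= 2 ^ m.
Proof.
pose up (p : 'S_m) : {set 'I_m} := [set b | p b == (q b).+1 :> nat].
have nearP (p : 'S_m) b : ~~ far p q -> (p b <= (q b).+1) && (q b <= (p b).+1).
  by rewrite negb_exists => /forallP/(_ b); lia.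
rewrite -(card_in_imset (f := up)); last first.
  move=> p p'; rewrite !inE => np np' eq_up; apply/permP=> b.
  (* Strong induction on [q b], with [k] as an upper bound for it. *)
  elim: {b}_.+1 {-2}b (ltnSn (q b)) => // k IHk b; rewrite ltnS => le_qb.
  (* [c] occupies under [p2] the place of [b] under [p1], so [q c < q b] and the
     induction hypothesis gives [p1 c = p2 c = p1 b] *)
  have below (p1 p2 : 'S_m) : ~~ far p2 q ->
      (forall c, q c < q b -> p1 c = p2 c) ->
      p1 b = (q b).-1 :> nat -> p2 b = q b -> 0 < q b -> False.
    move=> np2 IH p1b p2b qb_gt0.
    pose c := (p2^-1)%g (p1 b); have p2c : p2 c = p1 b by rewrite permKV.
    have neq_bc : c != b.
      by apply/eqP=> eq_cb; move: p2c p1b qb_gt0; rewrite eq_cb p2b => <-; lia.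
    have neq_q : q c != q b by rewrite (inj_eq perm_inj).
    have lt_q : q c < q b.
      rewrite ltn_neqAle neq_q /=.
      by have /andP[_] := nearP _ c np2; rewrite p2c p1b prednK.
    by case/eqP: neq_bc; apply: (@perm_inj _ p1); rewrite IH.
  have IHb c : q c < q b -> p c = p' c.
    by move=> lt_q; apply: IHk; apply: leq_trans lt_q _.
  have := congr1 (fun S : {set 'I_m} => b \in S) eq_up; rewrite !inE.
  have /andP[h1 h2] := nearP _ b np; have /andP[h3 h4] := nearP _ b np'.
  move=> eq_b; apply/val_inj/eqP/negPn/negP=> /= neq.
  (* As [up p] and [up p'] agree at [b], two different values there must be [q b] and its
     predecessor, in one order or the other; [below] refutes both orders. *)
  have [pb|pb] := eqVneq (p b) (q b).
    apply: (below p' p np) => //; rewrite ?pb //; first by move=> c /IHb.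
      by move: neq eq_b; rewrite pb; lia.
    by move: neq eq_b; rewrite pb; lia.
  have {}pb : p b != q b :> nat by [].
  apply: (below p p' np') => //; first by lia.
    by apply/val_inj => /=; lia.
  by lia.
by rewrite -[X in 2 ^ X]card_ord -cardsT -card_powerset subset_leq_card //
           powersetT subsetT.
Qed.

(** * Hamilton paths given by permutations of the vertices *)

Variable n : nat.

(* [g v] is the place of the vertex [v] on the path. *)
Definition perm_path (g : 'S_n) : {set {set 'I_n}} :=
  path_edges [tuple (g^-1)%g i | i < n].

Lemma perm_path_hamilton g : perm_path g \in hamilton_paths n.
Proof.
rewrite inE; apply/existsP; exists [tuple (g^-1)%g i | i < n].
by rewrite eqxx andbT map_inj_uniq ?enum_uniq //; apply: perm_inj.
Qed.

Lemma mem_path_edges (s : seq 'I_n) e :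
  reflect (exists x y s1 s2, s = s1 ++ [:: x, y & s2] /\ e = [set x; y])
          (e \in path_edges s).
Proof.
apply: (iffP idP) => [|[x [y [s1 [s2 [-> ->]]]]]].
  elim: s => [|x [|y s] IHs]; try by rewrite path_edges_small ?inE.
  rewrite path_edges_cons2 => /setU1P[->|/IHs[u [v [s1 [s2 [-> ->]]]]]].
    by exists x, y, [::], s.
  by exists u, v, (x :: s1), s2.
elim: s1 => [|z s1 IHs] /=; first by rewrite path_edges_cons2 setU11.
by case: s1 IHs => [|w s1] /= IHs; rewrite path_edges_cons2 inE IHs orbT.
Qed.

Lemma mem_perm_path (g : 'S_n) u v :
  ([set u; v] \in perm_path g) =
  ((g u == (g v).+1 :> nat) || (g v == (g u).+1 :> nat)).
Proof.
set s := val [tuple (g^-1)%g i | i < n].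
have idx w : index w s = g w.
  rewrite -[w in LHS](permK g) /s /= index_map; last exact: perm_inj.
  by rewrite index_enum_ord.
have us : uniq s by rewrite map_inj_uniq ?enum_uniq //; apply: perm_inj.
have edge x y : g y = (g x).+1 :> nat -> [set x; y] \in perm_path g.
  move=> gy; apply/mem_path_edges; exists x, y, (take (g x) s), (drop (g y).+1 s).
  split=> //; rewrite -/s.
  have sz : size s = n by rewrite size_tuple.
  have nthE w : nth x s (g w) = w.
    by rewrite -idx nth_index // -index_mem idx sz.
  rewrite -[LHS](cat_take_drop (g x)); congr (_ ++ _).
  by rewrite (drop_nth x) ?sz // nthE -gy (drop_nth x) ?sz // nthE.
apply/idP/orP => [/mem_path_edges[x [y [s1 [s2 [eq_s eq_e]]]]]|].
  have gxy : g y = (g x).+1 :> nat.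
    have {}eq_s : s = s1 ++ [:: x, y & s2] := eq_s.
    rewrite -!idx; move: us; rewrite eq_s.
    rewrite cat_uniq /= !inE !negb_or => /and5P[_ /and3P[xs1 ys1 _] /andP[xy _] _ _].
    rewrite !index_cat (negPf xs1) (negPf ys1) /= !eqxx (negPf xy); lia.
  have uxy : u \in [set x; y] by rewrite -eq_e set21.
  have vxy : v \in [set x; y] by rewrite -eq_e set22.
  have xuv : x \in [set u; v] by rewrite eq_e set21.
  have yuv : y \in [set u; v] by rewrite eq_e set22.
  have xy : x != y by apply/eqP=> xy; move: gxy; rewrite xy; lia.
  case/set2P: uxy vxy xuv yuv xy => -> /set2P[]->;
    rewrite !inE ?orbb ?gxy ?eqxx; auto.
    by move=> _ /eqP->; rewrite eqxx.
  by move=> /eqP->; rewrite eqxx.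
by case=> /eqP/edge //; rewrite setUC.
Qed.

Lemma perm_path_path3 (g h : 'S_n) x y z :
    g y = (g x).+1 :> nat -> g z = (g y).+1 :> nat ->
    [set x; y] \notin perm_path h -> [set y; z] \notin perm_path h ->
  path3_outside (perm_path g) (perm_path h).
Proof.
move=> gy gz xyh yzh; apply/existsP; exists [tuple x; y; z]; apply/andP; split.
  rewrite -(map_inj_uniq (@perm_inj _ g)) -(map_inj_uniq val_inj) /= !inE; lia.
rewrite !path_edges_cons2 path_edges_small // setU0 subUset !sub1set.
by rewrite !in_setD xyh yzh !mem_perm_path gz gy !eqxx !orbT.
Qed.

(** * Permuting the odd vertices only *)

Local Notation m := n./2.

Lemma odd_vertex_subproof (b : 'I_m) : b.*2.+1 < n.
Proof. by have := ltn_ord b; lia. Qed.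

Definition odd_vertex b := Ordinal (odd_vertex_subproof b).

(** For odd [v] one has [v./2 < m], so [insub] succeeds and the default [v] of [oapp] is never
    taken. *)
Definition blowup_fun (p : 'S_m) (v : 'I_n) : 'I_n :=
  if odd v then oapp (fun b => odd_vertex (p b)) v (insub v./2) else v.

Lemma blowup_fun_odd p b : blowup_fun p (odd_vertex b) = odd_vertex (p b).
Proof.
rewrite /blowup_fun /= odd_double /=.
by rewrite (_ : uphalf b.*2 = b) ?uphalf_double // valK.
Qed.

Lemma odd_vertexP (v : 'I_n) : odd v -> exists b, v = odd_vertex b.
Proof.
move=> ov; have lt_v : v./2 < m by have := ltn_ord v; lia.
by exists (Ordinal lt_v); apply/val_inj => /=; lia.
Qed.

Lemma blowup_fun_inj p : injective (blowup_fun p).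
Proof.
have cancel_fun : cancel (blowup_fun p) (blowup_fun p^-1).
  move=> v; have [/odd_vertexP[b ->]|ev] := boolP (odd v).
    by rewrite !blowup_fun_odd permK.
  by rewrite /blowup_fun !(negPf ev).
exact: can_inj cancel_fun.
Qed.

Definition blowup p : 'S_n := perm (@blowup_fun_inj p).

Lemma blowup_odd p b : blowup p (odd_vertex b) = odd_vertex (p b).
Proof. by rewrite permE blowup_fun_odd. Qed.

Lemma blowup_even p (v : 'I_n) : ~~ odd v -> blowup p v = v.
Proof. by move=> ev; rewrite permE /blowup_fun (negPf ev). Qed.

(** In the path of [p] the odd vertex [b] lies between the even vertices [(p b).*2] and
    [(p b).*2.+2]; in that of [q] its neighbours are at least [(q b).*2], which is larger than both.
    The path with the smaller place supplies the 3-vertex path: there the right neighbour certainly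
    exists, whereas for even [n] the vertex in the last odd place has none. *)
Lemma path3_blowup (p q : 'S_m) b : (p b).+1 < q b ->
  path3_outside (perm_path (blowup p)) (perm_path (blowup q)).
Proof.
move=> lt_pq; have lt_q := ltn_ord (q b).
have lt_x : (p b).*2 < n by lia.
have lt_z : (p b).*2.+2 < n by lia.
have ex : ~~ odd (Ordinal lt_x) by rewrite /= odd_double.
have ez : ~~ odd (Ordinal lt_z) by rewrite /= odd_double.
by apply: (@perm_path_path3 _ _ (Ordinal lt_x) (odd_vertex b) (Ordinal lt_z));
  rewrite ?mem_perm_path ?blowup_odd !blowup_even //=; lia.
Qed.

Lemma far_path3 (p q : 'S_m) : far p q ->
  path3_outside (perm_path (blowup p)) (perm_path (blowup q)) ||
  path3_outside (perm_path (blowup q)) (perm_path (blowup p)).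
Proof. by case/existsP=> b /orP[] /path3_blowup->; rewrite ?orbT. Qed.

Lemma path3_outside_irr (H : {set {set 'I_n}}) : ~~ path3_outside H H.
Proof.
apply/existsP=> -[[[|x [|y [|z []]]] //= ?]] /andP[_ /subsetP/(_ [set x; y])].
by rewrite setDv path_edges_cons2 setU11 inE => /(_ isT).
Qed.

Lemma M2_lower : m`! <= M2 n * 2 ^ m.
Proof.
have [G farG domG] := maximal_clique (@far m).
pose path p := perm_path (blowup p).
have pathG : {in G &, forall p q, p != q ->
    path3_outside (path p) (path q) || path3_outside (path q) (path p)}.
  by move=> p q pG qG /(farG _ _ pG qG)/far_path3.
(* Two members of [G] with the same Hamilton path would give a 3-vertex path lying in that path and
   outside it. *)
have path_inj : {in G &, injective path}.
  move=> p q pG qG eq_pq; apply/eqP/negPn/negP=> /(pathG _ _ pG qG).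
  by rewrite eq_pq orbb (negPf (path3_outside_irr _)).
have le_G : #|G| <= M2 n.
  rewrite -(card_in_imset path_inj).
  apply: (leq_bigmax_cond (F := fun F : {set {set {set 'I_n}}} => #|F|)).
  apply/andP; split.
    by apply/subsetP=> _ /imsetP[p _ ->]; apply: perm_path_hamilton.
  apply/forall_inP=> _ /imsetP[p pG ->]; apply/forall_inP=> _ /imsetP[q qG ->].
  by apply/implyP=> neq; apply: pathG => //; apply: contraNneq neq => ->.
apply: leq_trans (leq_mul le_G (leqnn _)).
rewrite -(card_Sn m) -sum_nat_const.
(* By maximality of [G] every permutation is near some member; a member of [G] is near itself. *)
have sub : [set: 'S_m] \subset \bigcup_(q in G) [set p | ~~ far p q].
  apply/subsetP=> p _; have [q qG near_pq] := domG p.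
  apply/bigcupP; exists q; rewrite // inE.
  case: near_pq => [->|]; last by rewrite [far q p]far_sym andbb.
  by apply/existsP=> -[b]; lia.
rewrite -cardsT; apply: leq_trans (subset_leq_card sub) _.
apply: leq_trans (leq_card_bigcup _ _) _.
by apply: leq_sum => q _; apply: card_near.
Qed.

End LowerBound.

Theorem theorem1 (n : nat) (hn : (0 < n)%N) :
  ((n./2)`!)%:R / 2 ^+ (n./2) <= ((M2 n)%:R : rat) /\
  (M2 n <= 2 ^ (uphalf n) * (uphalf n)`!)%N.
Proof.
split; last exact: M2_upper.
rewrite ler_pdivrMr ?exprn_gt0 // -natrX -natrM ler_nat.
exact: M2_lower.
Qed.
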